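(* Let $A$ and $B$ be subsets of an elementary abelian $2$-group $G$ such that $\langle A\rangle=\langle B\rangle=G$. If $|A+B|<\min\{|A|+|B|,|G|\}$ and $|B|\ge\left(1-\frac{k+1}{2^k}\right)|G|$ with integer $k\ge 4$, then the complement of $A+B$ in $G$ is contained in a coset of a subgroup of $G$ of index $2^k$. Moreover, if $\mu_{A,B}=1$, then the containment is strict (that is, the complement $G\setminus(A+B)$ is a proper subset of some coset of a subgroup of index $2^k$).
   Context: An elementary abelian $2$-group is a finite abelian group of exponent $2$. For subsets $A,B$ of an abelian group, $A+B:=\{a+b\colon a\in A,\ b\in B\}$. The notation $\langle A\rangle$ denotes the affine span of $A$, i.e. the smallest coset (of a subgroup) that contains $A$; thus $\langle A\rangle=G$ means that $A$ is not contained in a coset of a proper subgroup of $G$ (note that $\langle A\rangle$ is not the subgroup generated by $A$). For a group element $g$, $\nu_{A,B}(g)$ denotes the number of representations of $g$ in the form $g=a+b$ with $a\in A$ and $b\in B$ (i.e. the number of such pairs $(a,b)\in A\times B$), and $\mu_{A,B}:=\min\{\nu_{A,B}(g)\colon g\in A+B\}$. *)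

(* Defs.v *)
(* The abelian group is a subgroup G of an ambient finite group gT, written
   multiplicatively: the sumset A + B is the product set A * B of fingroup,
   and g = a + b reads g = a * b. *)
From mathcomp Require Import all_boot all_order all_algebra all_fingroup.
From mathcomp Require Import all_solvable.

Set Implicit Arguments.
Unset Strict Implicit.
Unset Printing Implicit Defensive.

Local Open Scope group_scope.

(* The intersection of all cosets (of all subgroups of G) containing A.  For
   nonempty A \subset G this is again a coset, hence the smallest one. *)
Definition affine_span (gT : finGroupType) (G : {group gT}) (A : {set gT}) :
    {set gT} :=
  \bigcap_(H in subgroups G) \bigcap_(C in rcosets H G | A \subset C) C.

Definition nu (gT : finGroupType) (A B : {set gT}) (g : gT) : nat :=
  #|[set p in setX A B | p.1 * p.2 == g]|.

(* The initial value #|A| * #|B| bounds every nu A B g from above, so it does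
   not affect the minimum as soon as A * B is nonempty. *)
Definition mu (gT : finGroupType) (A B : {set gT}) : nat :=
  \big[minn/(#|A| * #|B|)%N]_(g in A * B) nu A B g.

(* Main.v *)
Require Import Defs.
From mathcomp Require Import all_boot all_order all_algebra all_fingroup.
From mathcomp Require Import all_solvable.
From mathcomp Require Import zify.

(** Write D for the complement of A * B in G. As G has exponent 2, a * d = b
    forces d = a * b, so A * D misses B. Hence |A D| <= |G| - |B| is at most
    (k + 1) / 2 ^ k of |G|, and |A D| < |A| + |D| because
    |D| = |G| - |A B| > |G| - |A| - |B|. The containment is thus a statement on
    the pair (A, D): a set D that pairs so economically with a spanning set
    A must lie in a coset of index 2 ^ k. After translation 1 \in D; let
    F = <<D>>, of index 2 ^ c in G. What has to be shown is k <= c.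

    If 0 < c, let A meet the cosets of F in pieces A_i. Each piece satisfies
    Olson's bound |A_i D| >= |A_i| + |D| / 2 unless A_i D fills its coset
    (olson_bound); two unfilled cosets would give |A D| >= |A| + |D|, so there
    is at most one (card_mul_gen_lt). As A spans G, it meets at least c + 1
    cosets (card_mul_span), so |A D| > c |F| = (c / 2 ^ c) |G|, which is
    too large when c < k.

    If c = 0, both A and D span G, and then |A D| > (5 / 16) |G|
    (card_mul_spanning_pair), which is too large for 4 <= k.

    Olson's bound and the case c = 0 rest on the isoperimetric method of
    Hamidoune: the growth |X D| - |X|, over all X that are neither too small
    nor have too large an X D, is minimised by a subgroup
    (subgroup_excess_le). Exponent 2 makes this easy: a set that meets its
    translate by g contains with a point x of the intersection also g * x, so
    the intersection has two points.

    For the strictness, suppose that the complement of A * B is a full coset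
    H x, and let g = u * b be uniquely represented; put p = g * x, which is not
    in H. Counting the elements of A H missing from A, and those outside A H x
    missing from B, shows that at most |H| elements of A H lie outside p (A H).
    So A is contained in few cosets of the subgroup generated by H and p, fewer
    than a spanning set needs (unique_product_coset). *)

Set Implicit Arguments.
Unset Strict Implicit.
Unset Printing Implicit Defensive.

Import GRing.Theory Num.Theory.
Local Open Scope group_scope.

(** * Growth of a product set *)

Definition excess (gT : finGroupType) (D X : {set gT}) :=
  (#|(X * D)%g| - #|X|)%N.

(** Lemmas on groups elaborate the underlying finite type along different
    inheritance paths, so cardinals of the same set may fail to be identical
    syntactically; they are abstracted up to conversion before calling lia. *)
Ltac card_lia :=
  repeat match goal with
  | H : is_true (leq _ _) |- _ => revert H
  | H : @eq nat _ _ |- _ => revert H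
  end;
  repeat match goal with
  | |- context [excess ?D ?X] => move: (excess D X) => ?
  | |- context [@card ?T ?A] => move: (@card T A) => ?
  end; clear; lia.

Section Excess.

Variable gT : finGroupType.
Implicit Types (X Y D E : {set gT}) (g : gT).

Lemma leq_card_mulset X D : D != set0 -> #|X| <= #|X * D|.
Proof.
case/set0Pn=> d dD; rewrite -(card_rcoset X d) subset_leq_card //.
by rewrite mulgS // sub1set.
Qed.

Lemma card_mulset_excess D X :
  D != set0 -> #|X * D| = (#|X| + excess D X)%N.
Proof. by move=> D0; rewrite subnKC // leq_card_mulset. Qed.

(** Products distribute over unions, while the product of an intersection is
    only contained in the intersection of the products. *)
Lemma excess_submod D X Y : D != set0 ->
  excess D (X :|: Y) + excess D (X :&: Y) <= excess D X + excess D Y.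
Proof.
move=> D0; have := cardsUI X Y; have := cardsUI (X * D) (Y * D).
have : #|(X :&: Y) * D| <= #|X * D :&: Y * D|.
  by apply: subset_leq_card; rewrite subsetI !mulSg ?subsetIl ?subsetIr.
have <- : (X :|: Y) * D = X * D :|: Y * D by rewrite mulUg.
rewrite !card_mulset_excess //; card_lia.
Qed.

Lemma mul_lcoset g X D : (g *: X) * D = g *: (X * D).
Proof. by rewrite mulgA. Qed.

Lemma excess_lcoset D X g : excess D (g *: X) = excess D X.
Proof. by rewrite /excess mul_lcoset !card_lcoset. Qed.

End Excess.

(** * Elementary abelian 2-groups *)

Section Elementary.

Variables (gT : finGroupType) (G : {group gT}).
Hypothesis abelG : 2.-abelem G.
Implicit Types (A X Y D E : {set gT}) (H K L T : {group gT}).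

Lemma abelem2_sqr x : x \in G -> x * x = 1.
Proof. by case/(abelemP (isT : prime 2)): abelG => _ h /h. Qed.

Lemma abelem2_inv x : x \in G -> x^-1 = x.
Proof. by move=> xG; apply/eqP; rewrite eq_invg_mul abelem2_sqr. Qed.

Lemma abelem2_mulKg x y : x \in G -> x * (x * y) = y.
Proof. by move=> xG; rewrite mulgA abelem2_sqr // mul1g. Qed.

Lemma abelem2_comm x y : x \in G -> y \in G -> x * y = y * x.
Proof. by move=> xG yG; have /centsP := abelem_abelian abelG; apply. Qed.

Lemma abelem2_mulC X Y : X \subset G -> Y \subset G -> X * Y = Y * X.
Proof.
move=> sX sY; apply: centC.
exact: sub_abelian_cent2 (abelem_abelian abelG) sX sY.
Qed.

(** One step in a chain of subgroups, each of index 2 in the next. *)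
Lemma abelem2_double L a : L \subset G -> a \in G -> a \notin L ->
  exists L' : {group gT},
    [/\ L' \subset G, L' = L :|: a *: L :> {set gT} & #|L'| = (2 * #|L|)%N].
Proof.
move=> sLG aG aL.
have Lm (x y : gT) : x \in L -> (x * y \in L) = (y \in L) by apply: groupMl.
have gs : group_set (L :|: a *: L).
  apply/group_setP; split=> [|x y]; first by rewrite inE group1.
  rewrite !inE !mem_lcoset abelem2_inv // => Hx Hy.
  have [xL|xL] := boolP (x \in L).
    have xG := subsetP sLG _ xL.
    by rewrite mulgA (abelem2_comm aG xG) -mulgA !(Lm x) //.
  rewrite (negPf xL) /= in Hx.
  have xE : x = a * (a * x) by rewrite abelem2_mulKg.
  rewrite xE {xE}; move: (a * x) Hx => z zL.
  have zG : z \in G by apply: (subsetP sLG).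
  have -> : a * z * y = z * (a * y) by rewrite (abelem2_comm aG zG) mulgA.
  have -> : a * (z * (a * y)) = z * y.
    by rewrite mulgA (abelem2_comm aG zG) -mulgA abelem2_mulKg.
  by rewrite !(Lm z) // orbC.
exists (Group gs); split=> //=.
  rewrite subUset sLG /=; apply/subsetP=> x.
  by rewrite mem_lcoset => /(subsetP sLG); rewrite groupMl // groupV.
suff I0 : L :&: a *: L = set0.
  by rewrite cardsU I0 cards0 card_lcoset subn0 mul2n addnn.
apply/setP=> x; rewrite !inE mem_lcoset abelem2_inv //.
apply/andP=> -[xL]; apply/negP; by rewrite groupMr.
Qed.

(** * Growth is minimal on a subgroup *)

(** Take M, among the T-periodic sets subject to the two size conditions,
    first with the least excess and then with the least size. The set
    G :\: M * D satisfies the same conditions with no larger excess, so it is at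
    least as large as M, which bounds |M| in terms of the excess. If M meets a
    translate g M different from M, the intersection has at least two cosets
    of T, hence at least s elements; being smaller than M it has a larger
    excess, so by submodularity the union has a smaller one, so the union
    violates the size condition, and this contradicts the bound on |M|. Hence
    M is a coset of its stabiliser. The parameter s is 1 with T trivial for
    Olson's bound, and 2 |T| for a result on the quotient by T. *)
Lemma subgroup_excess_le T (D X : {set gT}) s :
  T \subset G -> D \subset G -> D != set0 ->
  0 < s <= 2 * #|T| ->
  X \subset G -> T * X \subset X -> s <= #|X| -> #|X * D| + s <= #|G| ->
  exists K : {group gT}, [/\ K \subset G, T \subset K, s <= #|K|,
     #|K * D| + s <= #|G| & excess D K <= excess D X].
Proof.
move=> sTG sDG D0 /andP[s0 sT] sXG TX sX XD.
pose F (Y : {set gT}) := [&& Y \subset G, T * Y \subset Y, s <= #|Y|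
   & #|Y * D| + s <= #|G|].
have FX : F X by apply/and4P.
case: (arg_minnP (excess D) FX) => M0 FM0 minM0.
have FM0' : F M0 && (excess D M0 == excess D M0) by rewrite FM0 eqxx.
case: (@arg_minnP _ M0 (fun Y => F Y && (excess D Y == excess D M0))
         (fun Y : {set gT} => #|Y|) FM0') => M /andP[FM /eqP eM] minM.
have {minM0} minf Y : F Y -> excess D M <= excess D Y.
  by rewrite eM; apply: minM0.
have {minM} minc Y : F Y -> excess D Y <= excess D M -> #|M| <= #|Y|.
  move=> FY le; apply: minM; rewrite FY /= eqn_leq -eM le /=; exact: minf.
case/and4P: (FM) => sMG TM sM MD.
have mulT (Y : {set gT}) t y :
    T * Y \subset Y -> t \in T -> y \in Y -> t * y \in Y.
  by move=> TY tT yY; apply: (subsetP TY); apply: mem_mulg.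
have MDG : M * D \subset G by rewrite mul_subG.
(* G :\: M * D competes with M, since its product with D misses M. *)
have dual : #|M| + #|M * D| <= #|G|.
  set M' := G :\: M * D.
  have cM' : #|M'| = (#|G| - #|(M * D)%g|)%N by rewrite cardsDS.
  have M'D : #|M' * D| + #|M| <= #|G|.
    rewrite -(cardsID M G) addnC (setIidPr sMG) leq_add2l subset_leq_card //.
    apply/subsetP=> _ /mulsgP[y d /setDP[yG yMD] dD ->].
    have dG := subsetP sDG _ dD.
    rewrite !inE groupM // andbT; apply: contra yMD => ydM.
    by rewrite -[y]mulg1 -(abelem2_sqr dG) mulgA mem_mulg.
  have FM' : F M'.
    apply/and4P; split; rewrite ?subsetDl //; [|card_lia|card_lia].
    apply/subsetP=> _ /mulsgP[t y tT /setDP[yG yMD] ->].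
    have tG := subsetP sTG _ tT.
    rewrite !inE groupM // andbT; apply: contra yMD => /mulsgP[m d mM dD E].
    apply/mulsgP; exists (t * m) d => //; first exact: mulT.
    by rewrite -mulgA -E abelem2_mulKg.
  have := leq_card_mulset M D0; have := leq_card_mulset M' D0.
  have := minc _ FM'; rewrite /excess; card_lia.
have trans g : g \in G -> M :&: g *: M != set0 -> g *: M = M.
  move=> gG meet; apply/eqP/negP=> /negP neq.
  have ggM : g *: (g *: M) = M by rewrite -!lcosetM abelem2_sqr // lcoset1.
  set gM := g *: M in meet neq ggM *.
  have sgMG : gM \subset G.
    apply/subsetP=> y; rewrite mem_lcoset => /(subsetP sMG).
    by rewrite groupMl // groupV.
  have cgM : #|gM| = #|M| by rewrite card_lcoset.
  have TgM : T * gM \subset gM.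
    apply/subsetP=> _ /mulsgP[t y tT yM ->].
    move: yM; rewrite !mem_lcoset (abelem2_inv gG) => yM.
    have tG := subsetP sTG _ tT.
    by rewrite mulgA (abelem2_comm gG tG) -mulgA mulT.
  set I := M :&: gM; set U := M :|: gM.
  have TI : T * I \subset I.
    rewrite subsetI (subset_trans (mulgS _ (subsetIl _ _)) TM).
    by rewrite (subset_trans (mulgS _ (subsetIr _ _)) TgM).
  have gI x : x \in I -> g * x \in I.
    by rewrite !inE !mem_lcoset mulKg (abelem2_inv gG) andbC.
  have gNT : g \notin T.
    apply: contra neq => gT0; rewrite eqEcard cgM leqnn andbT.
    apply/subsetP=> y; rewrite mem_lcoset abelem2_inv // => yM.
    by rewrite -(abelem2_mulKg y gG) mulT.
  (* g is not in T, so the subgroup L = T :|: g T has 2 |T| elements; a whole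
     coset of L lies in M :&: g M. *)
  have sI : s <= #|I|.
    apply: leq_trans sT _.
    have [L [_ LE <-]] := abelem2_double sTG gG gNT.
    case/set0Pn: meet => x xI; rewrite -(card_rcoset L x) subset_leq_card //.
    apply/subsetP=> y; rewrite mem_rcoset LE inE mem_lcoset.
    case/orP=> [yT|yT].
      by rewrite -[y](mulgKV x) mulT.
    rewrite -[y](mulgKV x) -(mulKVg g (y * x^-1)) -mulgA gI //.
    exact: mulT.
  have FI : F I.
    apply/and4P; split=> //; first by rewrite subIset ?sMG.
    have : #|I * D| <= #|M * D| by rewrite subset_leq_card // mulSg // subsetIl.
    card_lia.
  have ltI : #|I| < #|M|.
    rewrite ltnNge; apply: contra neq => le.
    have /eqP EI : I == M by rewrite eqEcard subsetIl.
    by rewrite eq_sym eqEcard cgM leqnn andbT -{1}EI subsetIr.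
  have fI : excess D M < excess D I.
    by rewrite ltnNge; apply/negP=> /(minc _ FI); rewrite leqNgt ltI.
  have := excess_submod M gM D0; rewrite -/I -/U excess_lcoset => sub.
  have fU : excess D U < excess D M by card_lia.
  have nFU : ~ F U by move=> /minf; card_lia.
  have cU : #|U| + #|I| = (2 * #|M|)%N by rewrite cardsUI cgM; card_lia.
  (* |U| <= 2 |M| - s and |U D| > |G| - s give an excess of U above
     |G| - 2 |M|, which is at least the excess of M by the dual inequality. *)
  have [//|] := leqP (#|U * D| + s) #|G|.
    move=> UD; case: nFU; apply/and4P; split=> //.
    - by rewrite subUset sMG.
    - by rewrite mulgU setUSS.
    - card_lia.
  have := card_mulset_excess U D0; have := card_mulset_excess M D0; card_lia.
have /set0Pn[m mM] : M != set0 by rewrite -card_gt0 (leq_trans s0).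
have mG := subsetP sMG _ mM.
pose K := m *: M.
have MK : m *: K = M by rewrite -lcosetM abelem2_sqr // lcoset1.
have gs : group_set K.
  apply/group_setP; split=> [|x y].
    by rewrite mem_lcoset mulg1 abelem2_inv.
  rewrite !mem_lcoset abelem2_inv // => xM yM.
  have xG : x \in G by rewrite -(abelem2_mulKg x mG) groupM // (subsetP sMG).
  rewrite mulgA (abelem2_comm mG xG) -mulgA.
  have <- : x *: M = M.
    apply: trans => //; apply/set0Pn; exists (m * x).
    by rewrite inE xM mem_lcoset abelem2_inv // abelem2_comm // abelem2_mulKg.
  by rewrite mem_lcoset mulKg.
have cK : #|K| = #|M| by rewrite card_lcoset.
exists (Group gs); split=> /=.
- apply/subsetP=> x; rewrite mem_lcoset => /(subsetP sMG).
  by rewrite groupMl ?groupV.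
- apply/subsetP=> t tT; have tG := subsetP sTG _ tT.
  by rewrite mem_lcoset abelem2_inv // abelem2_comm // mulT.
- by rewrite cK.
- by rewrite mul_lcoset card_lcoset.
- by rewrite excess_lcoset minf.
Qed.

(** * Spanning sets meet many cosets *)

(** By induction on the index of a subgroup L between K and G: while L is not G,
    some a \in A lies outside L, and the coset a K is disjoint from L and
    contained in the subgroup L :|: a L of half the index. *)
Lemma card_mul_span1 A K m :
  A \subset G -> 1 \in A -> <<A>> = G -> K \subset G -> #|G : K| = (2 ^ m)%N ->
  m.+1 * #|K| <= #|A * K|.
Proof.
move=> sAG A1 genA sKG iK.
suff main L j : K \subset L -> L \subset G -> #|G : L| = (2 ^ j)%N ->
    j * #|K| <= #|A * K :\: L|.
  have := main K m (subxx _) sKG iK.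
  rewrite -(cardsID K (A * K)) (setIidPr _); first by card_lia.
  by rewrite -{1}(mul1g K) mulSg // sub1set.
elim: j L => [|j IH] L sKL sLG iL; first by rewrite mul0n.
have /subsetPn[a aA aL] : ~~ (A \subset L).
  apply/negP=> sAL; have : G \subset L by rewrite -genA gen_subG.
  move=> /(conj sLG)/andP; rewrite -eqEsubset => /eqP E.
  by move: iL; rewrite E indexgg expnS; card_lia.
have aG := subsetP sAG _ aA.
have [L' [sL'G EL' cL']] := abelem2_double sLG aG aL.
have sLL' : L \subset L' by rewrite EL' subsetUl.
have iL' : #|G : L'| = (2 ^ j)%N.
  apply/eqP; rewrite -(@eqn_pmul2l #|L'|) ?cardG_gt0 // Lagrange //.
  by rewrite cL' -(Lagrange sLG) iL expnS -mulnA mulnCA.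
have := IH L' (subset_trans sKL sLL') sL'G iL'.
rewrite -[in X in _ -> X](cardsID L' (_ :\: _)) mulSn => le.
apply: leq_add.
  rewrite -(card_lcoset K a) subset_leq_card //.
  apply/subsetP=> y yaK; rewrite !inE EL' inE.
  have yaL : y \in a *: L by move: yaK; rewrite !mem_lcoset; apply: subsetP.
  rewrite yaL orbT andbT; apply/andP; split; last first.
    by apply: (subsetP (mulSg _ _)) yaK; rewrite sub1set.
  move: yaL; rewrite mem_lcoset abelem2_inv // => ayL.
  by apply: contra aL => yL; move: ayL; rewrite groupMr.
apply: leq_trans le _; rewrite subset_leq_card //.
apply/subsetP=> y; rewrite !inE => /andP[yL' ->].
by rewrite yL' andbT; apply: contra yL'; apply: subsetP.
Qed.

End Elementary.

(** * Transversals *)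

Section Critical.

Variable gT : finGroupType.
Implicit Types (A B X Y D E : {set gT}) (F G H K L T : {group gT}).

(** The elements of R are the canonical representatives of the traces of X on
    the cosets of H. *)
Lemma lcoset_transversal X H : exists R : {set gT},
  [/\ R \subset X, X \subset R * H
    & {in R &, forall x y, x^-1 * y \in H -> x = y}].
Proof.
pose r x := repr (X :&: x *: H).
have rP x : x \in X -> r x \in X :&: x *: H.
  by move=> xX; apply: (mem_repr x); rewrite inE xX lcoset_refl.
have rE x y : x^-1 * y \in H -> r x = r y.
  move=> xy; rewrite /r; congr (repr (_ :&: _)); apply/lcoset_eqP.
  by rewrite lcoset_sym mem_lcoset.
exists [set x in X | r x == x]; split.
- by apply/subsetP=> x; rewrite inE => /andP[].
- apply/subsetP=> x xX; have := rP _ xX; rewrite inE mem_lcoset => /andP[rX rH].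
  rewrite -(mulKVg (r x) x) mem_mulg ?inE ?rX //=.
    by rewrite -(rE _ _ rH).
  by rewrite -groupV invMg invgK.
- move=> x y; rewrite !inE => /andP[_ /eqP {2}<-] /andP[_ /eqP {2}<-].
  exact: rE.
Qed.

(** If x * e = y * f with e and f in one coset of H, then x and y lie in one
    coset of H. *)
Lemma card_mul_transversal G H X E d :
  abelian G -> X \subset G -> H \subset G ->
  d \in G -> E \subset d *: H ->
  {in X &, forall x y, x^-1 * y \in H -> x = y} ->
  #|X * E| = (#|X| * #|E|)%N.
Proof.
move=> /centsP cG sX sH dG sE inj.
rewrite -cardsX -(_ : (fun p => p.1 * p.2) @: setX X E = X * E).
  rewrite card_in_imset // => -[x e] [y f] /setXP[/= xX eE] /setXP[/= yX fE] eq.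
  suff xy : x = y by move: eq; rewrite xy => /mulgI ->.
  apply: inj => //.
  have -> : x^-1 * y = e * f^-1.
    by apply: (mulgI x); rewrite mulKVg mulgA eq mulgK.
  have := subsetP sE _ eE; have := subsetP sE _ fE.
  rewrite !mem_lcoset => fH eH.
  have -> : e * f^-1 = (d^-1 * e) * (d^-1 * f)^-1.
    rewrite invMg invgK.
    have -> : d^-1 * e * (f^-1 * d) = (d^-1 * e) * f^-1 * d by rewrite mulgA.
    have eG : e \in G by rewrite -(mulKVg d e) groupM // (subsetP sH).
    have fG : f \in G by rewrite -(mulKVg d f) groupM // (subsetP sH).
    by rewrite -(cG d) ?groupM ?groupV // !mulgA mulgV mul1g.
  by rewrite groupM // groupV.
apply/setP=> z; apply/imsetP/mulsgP=> [[[x e] /setXP[/= xX eE] ->]|].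
  by exists x e.
case=> x e xX eE ->.
by exists (x, e); rewrite // inE xX.
Qed.

Lemma dvdn_card_mul X G H : abelian G -> X \subset G -> H \subset G ->
   #|H| %| #|X * H|.
Proof.
move=> cG sX sH; have [R [sRX sXR inj]] := lcoset_transversal X H.
have <- : R * H = X * H.
  by apply/eqP; rewrite eqEsubset mulSg //= -{2}(mulGid H) mulgA mulSg.
rewrite (@card_mul_transversal G H _ _ 1) ?lcoset1 ?dvdn_mull //.
exact: subset_trans sRX sX.
Qed.

(** * Critical pairs over the span of one factor *)

(** The growth of X is at least that of a proper subgroup K. As D generates F,
    it meets a coset of K other than K, so |K D| >= 2 |K| and the growth of K is
    at least |K D| / 2. *)
Lemma olson_bound F D X : 2.-abelem F -> 1 \in D -> <<D>> = F ->
  X != set0 -> X \subset F -> ~~ (F \subset X * D) ->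
  2 * #|X| + #|D| <= 2 * #|X * D|.
Proof.
move=> abF D1 genD X0 sX nF.
have sDF : D \subset F by rewrite -genD subset_gen.
have D0 : D != set0 by apply/set0Pn; exists 1.
have XDF : X * D \subset F by rewrite mul_subG.
have lt : #|X * D| + 1 <= #|F|.
  by rewrite addn1 proper_card // properE XDF.
have [|||K [sKF _ _ KD le]] :=
  @subgroup_excess_le gT F abF 1%G D X 1 (sub1G _) sDF D0 _ sX _ _ lt.
- by rewrite /= cards1.
- by rewrite mul1g.
- by rewrite card_gt0.
have [d dD dK] : exists2 d, d \in D & d \notin K.
  apply/subsetPn; apply/negP => sDK.
  have sFK : F \subset K by rewrite -genD gen_subG.
  have : #|F| <= #|K * D|.
    by rewrite subset_leq_card // (subset_trans sFK) //
               -{1}(mulg1 K) mulgS ?sub1set.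
  card_lia.
have dF := subsetP sDF _ dD.
have [L [_ EL cL]] := abelem2_double abF sKF dF dK.
have leL : #|L| <= #|K * D|.
  rewrite subset_leq_card // EL subUset -{1}(mulg1 K) mulgS ?sub1set //=.
  by rewrite (abelem2_mulC abF) ?sub1set // mulgS // sub1set.
have leD : #|D| <= #|K * D|.
  by rewrite subset_leq_card // -{1}(mul1g D) mulSg ?sub1G.
have := card_mulset_excess K D0; have := card_mulset_excess X D0.
card_lia.
Qed.

Lemma olson_coset F D X y : 2.-abelem F -> 1 \in D -> <<D>> = F ->
  X != set0 -> X \subset y *: F -> ~~ (y *: F \subset X * D) ->
  2 * #|X| + #|D| <= 2 * #|X * D|.
Proof.
move=> abF D1 genD X0 sX nF.
have := @olson_bound F D (y^-1 *: X) abF D1 genD.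
rewrite mul_lcoset !card_lcoset; apply.
- by rewrite -card_gt0 card_lcoset card_gt0.
- by rewrite -(lcosetK y F) mulgS.
- by apply: contra nF => sF; rewrite -(lcosetKV y (X * D)) mulgS.
Qed.

(** Two cosets of <<D>> met by A but not filled by A * D would each contribute
    a growth of |D| / 2 by Olson's bound. So at most one coset is not filled,
    and a nonempty part of it lies in A * D. *)
Lemma card_mul_gen_lt G A D : 2.-abelem G -> A \subset G -> D \subset G ->
  1 \in D -> #|A * D| < #|A| + #|D| -> #|A * <<D>>| < #|A * D| + #|<<D>>|.
Proof.
move=> abG sA sD D1 lt; set F := <<D>>%G; rewrite -[<<D>>]/(gval F).
have sFG : F \subset G by rewrite gen_subG.
have abF : 2.-abelem F by apply: abelemS abG.
have sDF : D \subset F by rewrite subset_gen.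
have D0 : D != set0 by apply/set0Pn; exists 1.
have [sAF|/subsetPn[y yAF yAD]] := boolP (A * F \subset A * D).
  apply: leq_ltn_trans (subset_leq_card sAF) _.
  by rewrite -addn1 leq_add2l cardG_gt0.
have meet z : z \in A * F -> A :&: z *: F != set0.
  case/mulsgP=> a f aA fF ->; apply/set0Pn; exists a.
  by rewrite inE aA mem_lcoset invMg -mulgA mulVg mulg1 groupV.
have half z : z \in A * F -> z \notin A * D ->
    2 * #|A :&: z *: F| + #|D| <= 2 * #|(A :&: z *: F) * D|.
  move=> zAF zAD; apply: (@olson_coset F D _ z) => //; first exact: meet.
    exact: subsetIr.
  apply: contra zAD => /subsetP/(_ z (lcoset_refl _ _)).
  by apply: subsetP; rewrite mulSg ?subsetIl.
have inc z : (A :&: z *: F) * D \subset z *: F.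
  rewrite (subset_trans (mulSg _ (subsetIr _ _))) //.
  by rewrite -{2}(mulGid F) mulgA mulgS.
have one : A * F :\: A * D \subset y *: F.
  apply/subsetP=> z /setDP[zAF zAD]; apply/negPn/negP=> zyF.
  have yz : [disjoint y *: F & z *: F].
    apply/pred0P=> w /=; apply/negP=> /andP[]; rewrite !mem_lcoset => yw zw.
    case/negP: zyF; rewrite mem_lcoset -(mulgK w y^-1) -mulgA groupM //.
    by rewrite -groupV invMg invgK.
  set Y := A :&: y *: F; set Z := A :&: z *: F.
  set R := (A :\: y *: F) :\: z *: F.
  have hY := half _ yAF yAD; have hZ := half _ zAF zAD.
  have cR := leq_card_mulset R D0.
  have dis (U V : {set gT}) :
      (forall v, v \in V -> v \in U -> False) -> [disjoint U & V].
    by move=> h; apply/pred0P=> v /=; apply/negP=> /andP[vU vV]; apply: (h v).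
  have nR w : w \in R * D -> w \notin y *: F :|: z *: F.
    case/mulsgP=> a d; rewrite !inE => /and3P[az ay aA] dD ->.
    have dF := subsetP sDF _ dD.
    move: az ay; rewrite !mem_lcoset !mulgA !(groupMr _ dF).
    by move=> /negPf-> /negPf->.
  have cAD : #|Y * D| + #|Z * D| + #|R * D| <= #|A * D|.
    have d1 : [disjoint Y * D & Z * D].
      exact: disjointWl (inc y) (disjointWr (inc z) yz).
    have d2 : [disjoint Y * D :|: Z * D & R * D].
      apply: dis => w /nR; rewrite !inE negb_or => /andP[wy wz] /orP[] wD.
        by rewrite (subsetP (inc y) _ wD) in wy.
      by rewrite (subsetP (inc z) _ wD) in wz.
    move: d1 d2; rewrite -!leq_card_setU => /eqP <- /eqP <-.
    rewrite subset_leq_card // -!mulUg mulSg // !subUset !subsetIl /=.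
    by rewrite (subset_trans (subsetDl _ _)) ?subsetDl.
  have cA : #|A| = (#|Y| + #|Z| + #|R|)%N.
    rewrite -(cardsID (y *: F) A) -(cardsID (z *: F) (A :\: _)) addnA.
    congr (_ + #|pred_of_set _| + _)%N.
    apply/setP=> w; rewrite !inE.
    case wz: (w \in z *: F); rewrite ?andbF // !andbT andbC.
    by rewrite (disjointFl yz wz) andbT.
  move: hY hZ; rewrite -/Y -/Z; card_lia.
rewrite -(cardsID (A * D) (A * F)) -addnS leq_add ?subset_leq_card ?subsetIr //.
rewrite -(card_lcoset F y) proper_card // properE one /=.
have /set0Pn[a /setIP[aA ay]] := meet y yAF.
apply/subsetPn; exists a => //; rewrite !inE negb_and negbK.
by rewrite -{1}(mulg1 a) mem_mulg.
Qed.

(** * Pairs that both span *)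

Lemma card_union_le3 (T : finType) (D U V W : {set T}) :
  #|D :&: (U :|: V :|: W)| <= #|D :&: U| + #|D :&: V| + #|D :&: W|.
Proof.
rewrite !setIUr (leq_trans (leq_card_setU _ _)) // leq_add2r.
exact: leq_card_setU.
Qed.

(** D lies neither in H nor in the subgroup H :|: d1 H: both are contained in
    H * D, which is not G. *)
Lemma three_cosets G H D : 2.-abelem G -> H \subset G ->
  1 \in D -> <<D>> = G -> H * D != G ->
  exists d1 d2, [/\ d1 \in D, d2 \in D
    & #|H :|: d1 *: H :|: d2 *: H| = (3 * #|H|)%N].
Proof.
move=> abG sHG D1 genD nHD.
have sDG : D \subset G by rewrite -genD subset_gen.
have out (L : {group gT}) : L \subset H * D -> exists2 d, d \in D & d \notin L.
  move=> sL; apply/subsetPn; apply: contra nHD => sDL.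
  rewrite eqEsubset mul_subG //= (subset_trans _ sL) //.
  by rewrite -genD gen_subG.
have sHD : H \subset H * D by rewrite -{1}(mulg1 H) mulgS // sub1set.
have [d1 d1D d1H] := out H sHD.
have d1G := subsetP sDG _ d1D.
have [L [sLG EL cL]] := abelem2_double abG sHG d1G d1H.
have sLD : L \subset H * D.
  rewrite EL subUset sHD (abelem2_mulC abG) ?sub1set //.
  by rewrite mulgS // sub1set.
have [d2 d2D d2L] := out L sLD.
exists d1, d2; split=> //; rewrite -EL.
have dis : L :&: d2 *: H = set0.
  apply/setP=> w; rewrite !inE; apply/andP=> -[wL]; rewrite mem_lcoset => wH.
  case/negP: d2L; rewrite -groupV -(mulgK w d2^-1) groupM ?groupV //.
  by rewrite EL inE wH.
by rewrite cardsU dis cards0 cL card_lcoset; card_lia.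
Qed.

(** Let H minimise the excess |K D| - |K| over the subgroups K with K D <> G,
    and be the largest such minimiser. Its excess is less than |D|, so D misses
    fewer than |H| elements of H D. Adding to A the cosets of H that it meets,
    one at a time, does not increase the excess, by submodularity. So the
    images of A and D in G / H still form a critical pair. Their product misses
    at most one element of G / H, since otherwise subgroup_excess_le would
    produce a minimiser larger than H. Hence |A H| + |H D| >= |G|, and one of
    the two terms is at least |G| / 2. If it is |H D|, then D itself is large.
    If it is |A H|, one of three cosets of H shares more than 2 / 3 of its
    elements with D, and multiplying a transversal of A H by this piece of D
    gives more than 2 / 3 of |A H|. *)
Lemma card_mul_spanning_pair G A D : 2.-abelem G -> A \subset G ->
  1 \in D -> <<D>> = G -> A != set0 ->
  {in A, forall a, <<a *: A>> = G} ->
  #|A * D| < #|A| + #|D| -> 5 * #|G| < 16 * #|A * D|.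
Proof.
move=> abG sAG D1 genD A0 spanA small; rewrite ltnNge; apply/negP=> thin.
have cG := abelem_abelian abG.
have sDG : D \subset G by rewrite -genD subset_gen.
have D0 : D != set0 by apply/set0Pn; exists 1.
have G0 : 0 < #|G| by apply: cardG_gt0.
have leD : #|D| <= #|A * D|.
  case/set0Pn: A0 => a aA; rewrite -(card_lcoset D a) subset_leq_card //.
  by rewrite mulSg // sub1set.
have ltAD : #|A * D| < #|G| by card_lia.
pose P (K : {group gT}) := (K \subset G) && (#|K * D| < #|G|).
have P1 : P 1%G by rewrite /P sub1G /= mul1g; card_lia.
have [H [/andP[sHG HD] minH maxH]] : exists H : {group gT}, [/\ P H,
    forall K : {group gT}, P K -> excess D H <= excess D K
  & forall K : {group gT}, P K -> excess D K <= excess D H -> #|K| <= #|H|].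
  case: (@arg_minnP _ 1%G P (fun K : {group gT} => excess D K) P1)
    => H0 PH0 minH0.
  have PH0' : P H0 && (excess D H0 == excess D H0) by rewrite PH0 eqxx.
  case: (@arg_maxnP _ H0 (fun K => P K && (excess D K == excess D H0))
         (fun K : {group gT} => #|K|) PH0') => H /andP[PH /eqP eH] maxH.
  exists H; split=> //.
    by move=> K PK; rewrite eH; apply: minH0.
  by move=> K PK le; apply: maxH; rewrite PK eqn_leq -eH le eH minH0.
have fH : excess D H < #|D|.
  have := minH _ P1; rewrite {2}/excess mul1g cards1.
  have : 0 < #|D| by rewrite card_gt0.
  by card_lia.
have h0 : 0 < #|H| by apply: cardG_gt0.
have cHD := card_mulset_excess H D0.
have nHD : H * D != G.
  by apply/eqP=> E; rewrite E ltnn in HD.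
(* Subgroups minimise the growth among all sets, not only among subgroups. *)
have atomH X : X != set0 -> X \subset G -> #|X * D| < #|G| ->
    excess D H <= excess D X.
  move=> X0 sX XD; rewrite -addn1 in XD.
  have [|||K [sKG _ _ KD le]] :=
    @subgroup_excess_le gT G abG 1%G D X 1 (sub1G _) sDG D0 _ sX _ _ XD.
  - by rewrite /= cards1.
  - by rewrite mul1g.
  - by rewrite card_gt0.
  by rewrite (leq_trans _ le) // minH // /P sKG -addn1.
(* Of the sets between A and A H that do not exceed the excess of A, a largest
   one Y is A H: a coset z H not contained in Y meets Y in a set of excess at
   least that of H, so Y :|: z H is again such a set. *)
have satA : excess D (A * H) <= excess D A.
  pose Q Y := [&& A \subset Y, Y \subset A * H & excess D Y <= excess D A].
  have QA : Q A by rewrite /Q subxx leqnn -{1}(mulg1 A) mulgS // sub1G.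
  case: (@arg_maxnP _ A Q (fun Y : {set gT} => #|Y|) QA)
    => Y /and3P[sAY sY fY] maxY.
  have [sAHY|/subsetPn[z zAH zY]] := boolP (A * H \subset Y).
    by have -> : A * H = Y by apply/eqP; rewrite eqEsubset sAHY.
  have zG : z \in G by apply: (subsetP _ _ zAH); rewrite mul_subG.
  have szH : z *: H \subset A * H.
    by rewrite -{2}(mulGid H) mulgA mulSg // sub1set.
  have le : excess D H <= excess D (Y :&: z *: H).
    apply: atomH.
    - case/mulsgP: zAH => a h aA hH ->; apply/set0Pn; exists a.
      apply/setIP; split; first exact: (subsetP sAY).
      by rewrite mem_lcoset invMg -mulgA mulVg mulg1 groupV.
    - by rewrite (subset_trans (subsetIl _ _)) // (subset_trans sY) ?mul_subG.
    - apply: leq_ltn_trans HD.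
      rewrite -(card_lcoset (H * D) z) subset_leq_card //.
      by rewrite -mul_lcoset mulSg // subsetIr.
  have := excess_submod Y (z *: H) D0; rewrite excess_lcoset => sub.
  have QU : Q (Y :|: z *: H).
    rewrite /Q (subset_trans sAY) ?subsetUl //= subUset sY szH /=.
    by card_lia.
  have /= := maxY _ QU; rewrite leqNgt => /negP[].
  rewrite proper_card // properE subsetUl /=; apply/subsetPn; exists z => //.
  by rewrite inE lcoset_refl orbT.
have cAHD := card_mulset_excess (A * H) D0.
have cA := card_mulset_excess A D0.
have dG : #|H| %| #|G| by apply: cardSg.
have dAH : #|H| %| #|A * H| by apply: (dvdn_card_mul cG).
have dHD : #|H| %| #|H * D|.
  by rewrite (abelem2_mulC abG) //; apply: (dvdn_card_mul cG).
have dAHD : #|H| %| #|A * H * D|.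
  rewrite -mulgA (abelem2_mulC abG sHG) // mulgA.
  by apply: (dvdn_card_mul cG) => //; rewrite mul_subG.
have sDHD : D \subset H * D by rewrite -{1}(mul1g D) mulSg ?sub1G.
have leDHD := subset_leq_card sDHD.
have two : 2 * #|H| <= #|A * H|.
  have nHG : H != G :> {set gT}.
    apply: contra nHD => /eqP E; rewrite eqEsubset mul_subG //=.
    by rewrite -{1}E -{1}(mulg1 H) mulgS ?sub1set.
  have [a aA] := set0Pn _ A0.
  have aG := subsetP sAG _ aA.
  have [x] : exists2 x, x \in a *: A & x \notin H.
    apply/subsetPn; apply/negP => sAH; case/eqP: nHG; apply/eqP.
    by rewrite eqEsubset sHG -(spanA a aA) gen_subG.
  rewrite mem_lcoset (abelem2_inv abG aG) => axA xH.
  have xG : x \in G.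
    by rewrite -(abelem2_mulKg abG x aG) groupM // (subsetP sAG).
  have [L [_ EL cL]] := abelem2_double abG sHG xG xH.
  rewrite -cL -(card_lcoset L a) subset_leq_card // EL mulgU subUset.
  by rewrite mulSg ?sub1set //= mulgA mulg_set1 mulSg // sub1set.
(* All terms are multiples of |H|. In units of |H|, step says that the images of
   A and D form a critical pair in G / H, and wide that at most one element of
   G / H is missing from their product. *)
have fill : #|G| <= #|A * H| + #|H * D|.
  have fAH : excess D (A * H) < #|D| by card_lia.
  have mult m n : #|H| %| m -> #|H| %| n -> m < n + #|H| -> m <= n.
    move=> /dvdnP[a ->] /dvdnP[b ->].
    by rewrite -mulSnr ltn_pmul2r // leq_pmul2r.
  have step : #|A * H * D| + #|H| <= #|A * H| + #|H * D|.
    by apply: mult; rewrite ?dvdn_add //; card_lia.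
  have HAH : H * (A * H) \subset A * H.
    by rewrite mulgA (abelem2_mulC abG sHG) // -mulgA mulGid.
  have sAHG : A * H \subset G by rewrite mul_subG.
  have sHH : 0 < 2 * #|H| <= 2 * #|H| by rewrite leqnn muln_gt0 h0.
  have wide : #|G| < #|A * H * D| + 2 * #|H|.
    rewrite ltnNge; apply/negP=> le.
    have [K [sKG _ cK KD fK]] :=
      subgroup_excess_le abG sHG sDG D0 sHH sAHG HAH two le.
    have PK : P K by rewrite /P sKG; card_lia.
    suff : excess D K <= excess D H by move=> /(maxH _ PK); card_lia.
    by card_lia.
  have := mult _ _ dG (dvdn_add dAHD (dvdnn _)).
  by card_lia.
have [d1 [d2 [d1D d2D cU]]] := three_cosets abG sHG D1 genD nHD.
set U := _ :|: _ in cU.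
have sub1 d : d \in D -> d *: H \subset H * D.
  by move=> dD; rewrite (abelem2_mulC abG sHG sDG) mulSg // sub1set.
have sU : U \subset H * D.
  by rewrite !subUset !sub1 // -{1}(lcoset1 H) sub1.
have leU := subset_leq_card sU.
(* If |H D| >= |G| / 2, then |H D| >= 3 |H| gives |D| > (2 / 3) |H D|. *)
have [half|half] := leqP #|G| (2 * #|H * D|); first by card_lia.
(* D misses fewer than |H| of the 3 |H| elements of U, so it misses fewer than a
   third of one of the three cosets in U. *)
have [d [E [dD sED sEH cE]]] : exists d E,
    [/\ d \in D, E \subset D, E \subset d *: H & 2 * #|H| < 3 * #|E|].
  have cUD : 2 * #|H| < #|D :&: U|.
    have := cardsID D U; rewrite setIC.
    have : #|U :\: D| <= #|H * D :\: D| by rewrite subset_leq_card // setSD.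
    by rewrite (cardsDS sDHD); card_lia.
  have := card_union_le3 D H (d1 *: H) (d2 *: H); rewrite -/U => le3.
  have [l0|l0] := ltnP (2 * #|H|) (3 * #|D :&: H|).
    by exists 1, (D :&: H); split=> //; rewrite ?lcoset1 ?subsetIl ?subsetIr.
  have [l1|l1] := ltnP (2 * #|H|) (3 * #|D :&: d1 *: H|).
    by exists d1, (D :&: d1 *: H); split=> //; rewrite ?subsetIl ?subsetIr.
  have [l2|l2] := ltnP (2 * #|H|) (3 * #|D :&: d2 *: H|).
    by exists d2, (D :&: d2 *: H); split=> //; rewrite ?subsetIl ?subsetIr.
  by card_lia.
have [R [sRA sAR inj]] := lcoset_transversal A H.
have sRG := subset_trans sRA sAG.
have dG' := subsetP sDG _ dD.
have cRE := card_mul_transversal cG sRG sHG dG' sEH inj.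
have cRH : #|A * H| <= #|R| * #|H|.
  rewrite -(card_mul_transversal cG sRG sHG (group1 G) _ inj) ?lcoset1 //.
  by rewrite subset_leq_card // -{2}(mulGid H) mulgA mulSg.
have : #|R * E| <= #|A * D| by rewrite subset_leq_card // mulgSS.
have : #|R| * (2 * #|H|).+1 <= #|R| * (3 * #|E|) by rewrite leq_mul2l cE orbT.
rewrite cRE mulnS !(mulnCA #|R|).
move: (#|R| * #|H|)%N cRH (#|R| * #|E|)%N => ? ? ?.
by card_lia.
Qed.

(** * Affine spans *)

(** A is contained in the coset of <<a *: A>> through a. *)
Lemma affine_span_gen G A a : 2.-abelem G -> A \subset G ->
  affine_span G A = G -> a \in A -> <<a *: A>> = G.
Proof.
move=> abG sAG spanA aA.
have aG := subsetP sAG _ aA.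
have sKG : <<a *: A>> \subset G.
  by rewrite gen_subG mul_subG ?sub1set.
have : G \subset <<a *: A>> :* a.
  rewrite -{1}spanA /affine_span (bigcap_min <<a *: A>>%G) ?inE //.
  rewrite (bigcap_min (<<a *: A>> :* a)) //.
  rewrite -rcosetE imset_f //=; apply/subsetP=> b bA.
  have bG := subsetP sAG _ bA.
  rewrite rcosetE mem_rcoset (abelem2_inv abG aG) (abelem2_comm abG bG aG).
  by rewrite mem_gen // mem_mulg ?set11.
move/subset_leq_card; rewrite card_rcoset => le.
by apply/eqP; rewrite eqEcard sKG.
Qed.

(** The trivial subgroup is a coset of itself containing the empty set. *)
Lemma affine_span_neq0 G A : G :!=: 1 -> affine_span G A = G -> A != set0.
Proof.
move=> G1; apply: contra_eq_neq => ->; apply: contra_neq G1 => E.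
apply/trivgP; rewrite -E /affine_span (bigcap_min 1%G) ?inE ?sub1G //.
rewrite (bigcap_min (1 :* 1)) ?mulg1 // ?sub0set ?andbT.
by rewrite -{1}(mulg1 1%g) -rcosetE imset_f.
Qed.

Lemma card_mul_span G A K m : 2.-abelem G -> A \subset G -> A != set0 ->
  {in A, forall a, <<a *: A>> = G} -> K \subset G -> #|G : K| = (2 ^ m)%N ->
  m.+1 * #|K| <= #|A * K|.
Proof.
move=> abG sAG /set0Pn[a aA] spanA sKG iK.
have aG := subsetP sAG _ aA.
rewrite -(card_lcoset (A * K) a) -mul_lcoset.
apply: (card_mul_span1 abG _ _ (spanA a aA)) => //.
  by rewrite mul_subG ?sub1set.
by rewrite mem_lcoset mulg1 (abelem2_inv abG).
Qed.

(** * Overgroups of given index *)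

Lemma overgroup_index G F k j : 2.-abelem G -> F \subset G ->
  #|G : F| = (2 ^ (j + k))%N ->
  exists H : {group gT}, [/\ F \subset H, H \subset G & #|G : H| = (2 ^ k)%N].
Proof.
move=> abG; elim: j F => [|j IH] F sFG iF; first by exists F.
have /subsetPn[a aG aF] : ~~ (G \subset F).
  by rewrite -indexg_eq1 iF addSn expnS; apply/eqP; lia.
have [L [sLG EL cL]] := abelem2_double abG sFG aG aF.
have sFL : F \subset L by rewrite EL subsetUl.
have [|H [sLH sHG iH]] := IH L sLG.
  apply/eqP; rewrite -(@eqn_pmul2l #|L|) ?cardG_gt0 // Lagrange //.
  by rewrite cL -(Lagrange sFG) iF addSn expnS -mulnA mulnCA.
by exists H; rewrite (subset_trans sFL).
Qed.

(** * Uniquely represented products *)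

(** In exponent 2 the only possible partner of a in a representation of g is
    g * a, so representations of g are counted by the a \in A with
    g * a \in B. *)
Lemma mu1_unique G A B : 2.-abelem G -> A \subset G -> B \subset G ->
  A * B != set0 -> mu A B = 1%N ->
  exists2 g, g \in A * B &
    exists2 u, u \in A & {in A, forall a, g * a \in B -> a = u}.
Proof.
move=> abG sAG sBG AB0 mu1.
have [g gAB nu1] : exists2 g, g \in A * B & nu A B g = 1%N.
  suff /exists_inP[g gAB /eqP nu1] : [exists g in A * B, nu A B g == 1%N].
    by exists g.
  apply: contraT; rewrite negb_exists_in => /forall_inP no.
  have nun g : g \in A * B -> nu A B g != 1%N by move=> /no.
  have : mu A B != 1%N.
    apply: (big_ind (fun m => m != 1%N)) => [|m n m1 n1|g gAB]; last exact: nun.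
      apply/eqP=> cAB; case/set0Pn: AB0 => g gAB; case/negP: (nun _ gAB).
      rewrite eqn_leq; apply/andP; split.
        rewrite -cAB -cardsX subset_leq_card //; apply/subsetP=> p.
        by rewrite inE => /andP[].
      case/mulsgP: gAB => a b aA bB ->; rewrite card_gt0; apply/set0Pn.
      exists (a, b).
      by rewrite !inE aA bB eqxx.
    by rewrite /minn; case: ifP.
  by rewrite mu1.
exists g => //.
have /cards1P[[u v] E] : #|[set p in setX A B | p.1 * p.2 == g]| == 1%N.
  by apply/eqP.
have uA : u \in A.
  by have := set11 (u, v); rewrite -E !inE => /andP[/andP[]].
exists u => // a aA gaB.
have aG := subsetP sAG _ aA.
have gG : g \in G by apply: (subsetP _ _ gAB); rewrite mul_subG.
have : (a, g * a) \in [set (u, v)].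
  rewrite -E !inE /= aA gaB /= (abelem2_comm abG gG aG) mulgA.
  by rewrite (abelem2_sqr abG) // mul1g.
by rewrite inE => /eqP[].
Qed.

(** Put S = A H and p = g x. An element z of S outside p S satisfies
    g z \notin S x, while B lies outside S x; so unless z = u, either z \notin A
    or g z lies outside both S x and B. As |A| + |B| > |G| - |H|, there
    are at most |H| such z, whence S and p S together have at most
    (k + 2) |H| elements. They form A L for the subgroup L = H :|: p H of index
    2 ^ (k - 1), and A L has at least k |L| = 2 k |H| elements. *)
Lemma unique_product_coset G H A B k x g u :
  2.-abelem G -> A \subset G -> B \subset G ->
  A != set0 -> {in A, forall a, <<a *: A>> = G} ->
  #|A * B| < #|A| + #|B| ->
  H \subset G -> #|G : H| = (2 ^ k)%N -> (3 <= k)%N ->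
  #|A * H| <= k.+1 * #|H| ->
  x \in G -> G :\: A * B = H :* x ->
  g \in A * B -> u \in A -> {in A, forall a, g * a \in B -> a = u} -> False.
Proof.
move=> abG sAG sBG A0 spanA small sHG iH k3 cAH xG ED gAB uA uniq.
have sABG : A * B \subset G by rewrite mul_subG.
have gG := subsetP sABG _ gAB.
have cAB : #|A * B| + #|H| = #|G|.
  by rewrite -(cardsID (A * B) G) ED card_rcoset (setIidPr sABG).
pose p := g * x.
have pG : p \in G by rewrite groupM.
have pH : p \notin H.
  have : g \notin H :* x by rewrite -ED inE gAB.
  by rewrite mem_rcoset (abelem2_inv abG).
set S := A * H; have sSG : S \subset G by rewrite mul_subG.
have sSx : S :* x \subset G by rewrite mul_subG // sub1set.
have BS : B \subset G :\: S :* x.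
  apply/subsetP=> b bB; rewrite inE (subsetP sBG) // andbT.
  apply/negP; rewrite mem_rcoset => /mulsgP[a h aA hH E].
  have : h * x \in G :\: A * B by rewrite ED mem_rcoset mulgK.
  rewrite inE => /andP[/negP[]].
  have aG := subsetP sAG _ aA; have hG := subsetP sHG _ hH.
  have -> : h * x = a * b; last exact: mem_mulg.
  have -> : b = a * h * x by rewrite -E mulgKV.
  by rewrite -mulgA (abelem2_mulKg abG).
set Z := S :\: p *: S.
have leZ : #|Z| <= #|H|.
  have sAS : A \subset S by rewrite -{1}(mulg1 A) mulgS // sub1G.
  have le1 : #|Z :\: A| <= #|S| - #|A|.
    by rewrite -(cardsDS sAS) subset_leq_card // setSD // subsetDl.
  have le2 : #|(Z :&: A) :\ u| <= #|G| - #|S| - #|B|.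
    have -> : (#|G| - #|S| - #|B| = #|(G :\: S :* x) :\: B|)%N.
      by rewrite (cardsDS BS) (cardsDS sSx) card_rcoset.
    rewrite -(card_lcoset _ g) subset_leq_card //; apply/subsetP=> y.
    rewrite mem_lcoset (abelem2_inv abG gG).
    case/setD1P=> nu /setIP[/setDP[gyS gyp] gyA].
    have gyG := subsetP sAG _ gyA.
    have yE : y = g * (g * y) by rewrite (abelem2_mulKg abG).
    have yG : y \in G by rewrite yE groupM.
    rewrite !inE yG andbT; apply/andP; split.
      by apply: contra nu => yB; rewrite (uniq _ gyA) // -yE.
    apply: contra gyp; rewrite !mem_rcoset !mem_lcoset.
    rewrite (abelem2_inv abG xG) (abelem2_inv abG pG).
    suff -> : p * (g * y) = y * x by [].
    rewrite /p (abelem2_comm abG gG xG) -mulgA (abelem2_mulKg abG) //.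
    exact: abelem2_comm abG _ _ _ _.
  have le3 : #|Z :&: A| <= (#|(Z :&: A) :\ u|).+1.
    by rewrite (cardsD1 u); case: (_ \in _).
  have := cardsID A Z; have := subset_leq_card sAS; have := subset_leq_card BS.
  rewrite (cardsDS sSx) card_rcoset; have := subset_leq_card sSG.
  card_lia.
have [L [sLG EL cL]] := abelem2_double abG sHG pG pH.
have cAL : #|A * L| <= #|S| + #|H|.
  have -> : A * L = S :|: p *: S.
    rewrite EL mulgU; congr (_ :|: _).
    rewrite /S !mulgA; congr (_ * _); apply: (abelem2_mulC abG) => //.
    by rewrite sub1set.
  have := cardsID (p *: S) S; have := cardsID S (p *: S).
  rewrite setIC card_lcoset -/Z.
  have := cardsU S (p *: S); rewrite card_lcoset.
  have := subset_leq_card (subsetIl S (p *: S)).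
  card_lia.
have iL : #|G : L| = (2 ^ k.-1)%N.
  apply/eqP; rewrite -(@eqn_pmul2l #|L|) ?cardG_gt0 // Lagrange //.
  rewrite cL -(Lagrange sHG) iH -{1}(prednK (ltnW (ltnW k3))) expnS.
  by rewrite -mulnA mulnCA.
have := card_mul_span abG sAG A0 spanA sLG iL.
have := cardG_gt0 H; rewrite cL (prednK (ltnW (ltnW k3))) => h0 le.
have : k * (2 * #|H|) <= k.+2 * #|H|.
  apply: leq_trans le (leq_trans cAL _).
  by rewrite (mulSn k.+1) addnC leq_add2l.
by rewrite mulnA leq_pmul2r //; card_lia.
Qed.

End Critical.

(** * Arithmetic *)

(** The quotient (k + 1) / 2 ^ k decreases, so it suffices to compare it with
    c / 2 ^ c at k = c + 1, or at k = 3 if c = 1; for c = 1 and k = 2 the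
    inequality fails. *)
Lemma pow2_ratio c k : 0 < c -> c < k -> 2 < k -> k.+1 * 2 ^ c <= c * 2 ^ k.
Proof.
move=> c0; elim: k => [//|k IH] ck k3; rewrite expnS.
have [ltck|] := ltnP c k; last first.
  move=> lekc; have -> : c = k by apply/eqP; rewrite eqn_leq lekc andbT -ltnS.
  by rewrite [in X in _ <= X]mulnA leq_pmul2r ?expn_gt0 //; lia.
have [lt2k|] := ltnP 2 k; last first.
  move=> lek2; have -> : k = 2 by apply/eqP; rewrite eqn_leq lek2 -ltnS.
  by have -> : c = 1%N by lia.
have {IH}le := IH ltck lt2k.
apply: (@leq_trans (2 * (k.+1 * 2 ^ c))).
  by rewrite mulnA leq_pmul2r ?expn_gt0 //; lia.
by rewrite [in X in _ <= X]mulnCA leq_pmul2l.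
Qed.

Lemma pow2_five_sixteenths k : 3 < k -> 16 * k.+1 <= 5 * 2 ^ k.
Proof.
elim: k => [//|k IH] k4; rewrite expnS.
have [k3|k3] := ltnP 3 k; first by have := IH k3; lia.
by have -> : k = 3 by lia.
Qed.

(** * The theorem *)

Theorem theorem1 (gT : finGroupType) (G : {group gT}) (A B : {set gT}) (k : nat)
  (abG : abelian G) (expG : exponent G = 2%N)
  (sAG : A \subset G) (sBG : B \subset G)
  (spanA : affine_span G A = G) (spanB : affine_span G B = G)
  (small : (#|(A * B)%g| < minn (#|A| + #|B|) #|G|)%N)
  (k_ge4 : (4 <= k)%N)
  (largeB : ((1 - k.+1%:R / 2%:R ^+ k) * #|G|%:R <= #|B|%:R :> rat)%R) :
  exists (H : {group gT}) (C : {set gT}),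
    [/\ H \subset G,
        #|G : H| = (2 ^ k)%N,
        C \in rcosets H G,
        G :\: A * B \subset C
      & mu A B = 1%N -> G :\: A * B \proper C].
Proof.
have abelG : 2.-abelem G by rewrite abelemE // abG expG /=.
have largeB' : 2 ^ k * #|G| <= 2 ^ k * #|B| + k.+1 * #|G|.
  have k0 : (0 < 2 ^+ k :> rat)%R by rewrite exprn_gt0.
  rewrite -(ler_nat rat) natrD !natrM natrX.
  move: largeB; rewrite -(ler_pM2l k0) mulrA mulrBr mulr1 mulrCA.
  rewrite (divff (lt0r_neq0 k0)) mulr1.
  by rewrite mulrBl lerBlDr.
move: small; rewrite leq_min => /andP[small nfull].
have sABG : A * B \subset G by rewrite mul_subG.
have G1 : G :!=: 1 by apply/eqP=> E; move: expG; rewrite E exponent1.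
have A0 := affine_span_neq0 G1 spanA.
have B0 := affine_span_neq0 G1 spanB.
have spanA' : {in A, forall a, <<a *: A>> = G}.
  by move=> a aA; apply: affine_span_gen.
set D0 := G :\: A * B.
have [x xD0] : exists x, x \in D0.
  by apply/set0Pn; rewrite -card_gt0 cardsDS // subn_gt0.
have cD0 : #|D0| = (#|G| - #|(A * B)%g|)%N by rewrite cardsDS.
have sD0G : D0 \subset G by apply: subsetDl.
have xG := subsetP sD0G _ xD0.
pose D := x *: D0.
have sDG : D \subset G by rewrite mul_subG ?sub1set.
have D1 : 1 \in D by rewrite mem_lcoset mulg1 (abelem2_inv abelG).
have cAD : #|A * D| + #|B| <= #|G|.
  rewrite -(cardsID B G) addnC (setIidPr sBG) leq_add2l.
  have -> : A * D = x *: (A * D0).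
    rewrite /D !mulgA; congr (_ * _); apply: (abelem2_mulC abelG) => //.
    by rewrite sub1set.
  rewrite card_lcoset subset_leq_card //.
  apply/subsetP=> _ /mulsgP[a d aA dD ->].
  have aG := subsetP sAG _ aA; have dG := subsetP sD0G _ dD.
  rewrite inE groupM // andbT; move: dD; rewrite inE => /andP[nAB _].
  apply: contra nAB => adB.
  by rewrite -(abelem2_mulKg abelG d aG) mem_mulg.
have smallAD : #|A * D| < #|A| + #|D| by rewrite card_lcoset cD0; card_lia.
have thin : 2 ^ k * #|A * D| <= k.+1 * #|G|.
  rewrite -(leq_add2r (2 ^ k * #|B|)) -mulnDr.
  by apply: leq_trans (leq_mul (leqnn _) cAD) _; rewrite addnC.
set F := <<D>>%G.
have sFG : F \subset G by rewrite gen_subG.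
have /p_natP[c iF] : 2.-nat #|G : F|.
  by apply: pnat_dvd (dvdn_indexg _ _) (abelem_pgroup abelG).
have F0 : 0 < #|F| by apply: cardG_gt0.
have cG : #|G| = (2 ^ c * #|F|)%N by rewrite -(Lagrange sFG) iF mulnC.
have kc : k <= c.
  rewrite leqNgt; apply/negP=> ck.
  have [c0|c0] := posnP c.
    have genD : <<D>> = G.
      by apply/eqP; rewrite -[<<D>>]/(gval F) eqEcard sFG cG c0 mul1n leqnn.
    have := card_mul_spanning_pair abelG sAG D1 genD A0 spanA' smallAD.
    apply/negP; rewrite -leqNgt -(@leq_pmul2l (2 ^ k)%N) ?expn_gt0 // mulnCA.
    apply: leq_trans (leq_mul (leqnn 16) thin) _.
    by rewrite mulnA [in X in _ <= X]mulnA (mulnC (2 ^ k)%N) leq_mul2r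
               pow2_five_sixteenths ?orbT.
  have := card_mul_gen_lt abelG sAG sDG D1 smallAD; rewrite -[<<D>>]/(gval F).
  have := card_mul_span abelG sAG A0 spanA' sFG iF.
  rewrite mulSn => le1 le2.
  have lt : c * #|F| < #|A * D| by card_lia.
  have : 2 ^ k * (c * #|F|) < 2 ^ k * #|A * D| by rewrite ltn_pmul2l ?expn_gt0.
  move/leq_trans/(_ thin); rewrite cG !mulnA ltn_pmul2r // ltnNge.
  by rewrite (mulnC (2 ^ k)%N) (pow2_ratio c0 ck (ltnW k_ge4)).
have [H [sFH sHG iH]] : exists H : {group gT},
    [/\ F \subset H, H \subset G & #|G : H| = (2 ^ k)%N].
  by apply: (@overgroup_index _ G F k (c - k)); rewrite ?subnK.
have sDC : D0 \subset H :* x.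
  apply/subsetP=> d dD; rewrite mem_rcoset (abelem2_inv abelG xG).
  rewrite (abelem2_comm abelG _ xG) ?(subsetP sD0G) //.
  by rewrite (subsetP sFH) // mem_gen // mem_mulg ?set11.
exists H, (H :* x); split=> //; first by rewrite -rcosetE imset_f.
move=> mu1; rewrite properE sDC; apply/negP=> sCD.
have ED : D0 = H :* x by apply/eqP; rewrite eqEsubset sDC.
have AB0 : A * B != set0.
  case/set0Pn: A0 => a aA; case/set0Pn: B0 => b bB.
  by apply/set0Pn; exists (a * b); rewrite mem_mulg.
have [g gAB [u uA uniq]] := mu1_unique abelG sAG sBG AB0 mu1.
apply: (unique_product_coset abelG sAG sBG A0 spanA' small sHG iH
          _ _ xG ED gAB uA uniq).
  exact: ltnW.
have <- : A * D = A * H.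
  congr (_ * _); rewrite /D ED (abelem2_mulC abelG sHG) ?sub1set // mulgA.
  by rewrite mulg_set1 (abelem2_sqr abelG) // mul1g.
move: thin; rewrite -(Lagrange sHG) iH.
by rewrite (mulnC #|H|) mulnCA leq_pmul2l // expn_gt0.
Qed.
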